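(* Assume the polytopic dynamics $f(x,\theta)=\sum_{k=1}^K h_k(\theta)f_k(x)$, $G(x,\theta)=\sum_{k=1}^K h_k(\theta)G_k(x)$ described in the context. Suppose that $\eta>0$, $\mathcal{M}[\|\psi_0\|^2]<\infty$, and $\mathcal{M}[\|\psi_k\|^2]<\infty$ for $k\in\{1,\dots,K\}$, where $$\psi_0(x):=\begin{bmatrix} q(x)\\ \mathrm{vec}\big(\Phi(x)R(x)\Phi(x)^\top/2\big)\end{bmatrix},\qquad \psi_k(x):=\mathrm{vec}\Big(\frac{\partial\phi(x)}{\partial x^\top}\,\big[\,f_k(x),\ G_k(x)\Phi(x)^\top\,\big]\Big).$$ Then for any $w\in\mathbb{R}^{d_w}$ and any $\theta\in\mathbb{S}_\theta$, the minimization problem $$\min_{\tilde v\in\mathbb{R}^{d_v}}\Big(\mathcal{M}\big[B(\cdot,\tilde v,w,\theta)^2\big]+\eta\|\tilde v\|^2\Big)$$ has a unique solution $v(w,\theta)$, given by $$v(w,\theta)=-\Big(\sum_{k=1}^K\sum_{k'=1}^K h_k(\theta)h_{k'}(\theta)L_{k,k'}(w)\Big)^{-1}\sum_{k=1}^K h_k(\theta)\,l_k(w),$$ where $$L_{k,k'}(w):=\Big(\begin{bmatrix}1\\ w\end{bmatrix}\otimes I_{d_v}\Big)^{\top}\mathcal{M}\big[\psi_k\psi_{k'}^\top\big]\Big(\begin{bmatrix}1\\ w\end{bmatrix}\otimes I_{d_v}\Big)+\eta I_{d_v},$$ $$l_k(w):=\Big(\begin{bmatrix}1\\ w\end{bmatrix}\otimes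 I_{d_v}\Big)^{\top}\mathcal{M}\big[\psi_k\psi_0^\top\big]\begin{bmatrix}1\\ w\otimes w\end{bmatrix}.$$ Furthermore, the assumption $\eta>0$ is not needed (i.e. the conclusion also holds with $\eta\ge0$) if $L_{k,k'}(w)\succ0$ holds for all $k,k'\in\{1,\dots,K\}$.
   Context: Notation. $\mathrm{vec}$ is column-stacking vectorization, $\otimes$ the Kronecker product, $I_n$ the $n\times n$ identity, $\partial\phi(x)/\partial x^\top\in\mathbb{R}^{d_v\times d_x}$ the Jacobian of $\phi$. $L\succ0$ means $y^\top L y>0$ for all nonzero $y$. Dynamics. $\mathbb{S}_\theta\subseteq\mathbb{R}^{d_\theta}$ is a given set; $f(x,\theta)\in\mathbb{R}^{d_x}$, $G(x,\theta)\in\mathbb{R}^{d_x\times d_u}$. Polytopic dynamics: there are a positive integer $K$, continuous functions $h_k:\mathbb{S}_\theta\to[0,1]$ with $\sum_{k=1}^K h_k(\theta)=1$, and locally Lipschitz functions $f_k:\mathbb{R}^{d_x}\to\mathbb{R}^{d_x}$ with $f_k(0)=0$ and $G_k:\mathbb{R}^{d_x}\to\mathbb{R}^{d_x\times d_u}$ such that $f(x,\theta)=\sum_k h_k(\theta)f_k(x)$ and $G(x,\theta)=\sum_k h_k(\theta)G_k(x)$. Cost terms. $q:\mathbb{R}^{d_x}\to\mathbb{R}$ is continuous and globally positive definite ($q(0)=0$, $q(x)>0$ for $x\neq0$, $\lim_{\|x\|\to\infty}q(x)\ne0$); $R:\mathbb{R}^{d_x}\to\mathbb{R}^{d_u\times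 d_u}$ is continuous with symmetric positive definite values. Parameterization. $\Phi:\mathbb{R}^{d_x}\to\mathbb{R}^{d_w\times d_u}$ is locally Lipschitz, $\phi:\mathbb{R}^{d_x}\to\mathbb{R}^{d_v}$ is $C^1$ with $\phi(0)=0$; $\hat u(x,w):=\Phi(x)^\top w$ and $\hat J(x,\tilde v):=\phi(x)^\top\tilde v$. The Bellman residual is $$B(x,\tilde v,w,\theta):=q(x)+\tfrac12\hat u(x,w)^\top R(x)\hat u(x,w)+\frac{\partial \hat J(x,\tilde v)}{\partial x}^{\top}\Big(f(x,\theta)+G(x,\theta)\hat u(x,w)\Big).$$ Operator $\mathcal{M}$. For continuous $\pi:\mathbb{R}^{d_x}\to\mathbb{R}^{n\times m}$ (any $n,m$), $\mathcal{M}[\pi]:=\int_{\mathbb{R}^{d_x}}\mathcal{P}(x)\pi(x)\,dx$, where $\mathcal{P}:\mathbb{R}^{d_x}\to[0,\infty]$ is a predefined weight function such that $\mathcal{M}$ is linear, bounded, and well-defined for every such $\pi$. The constant $\eta\ge0$ is a free parameter. *)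

(* Defs.v *)
From HB Require Import structures.
From mathcomp Require Import all_boot all_order all_algebra.
From mathcomp Require Import all_classical all_reals all_analysis.
From mathcomp Require Import mxtens.

Set Implicit Arguments.
Unset Strict Implicit.
Unset Printing Implicit Defensive.

Import Order.TTheory GRing.Theory Num.Theory.
Import numFieldNormedType.Exports.

Local Open Scope classical_set_scope.
Local Open Scope ring_scope.

(* Lebesgue measure on R^n: the n-fold product of [lebesgue_measure], carried
   by [n.-tuple R] with its product (Borel) sigma-algebra, then completed. *)
Section lebesgue_measure_n.
Context (R : realType).
Local Notation Rn n := (n.-tuple (measurableTypeR R)).

Definition tuple_cons n (x : measurableTypeR R * Rn n) : Rn n.+1 :=
  [tuple of x.1 :: x.2].

Lemma measurable_tuple_cons n : measurable_fun setT (@tuple_cons n).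
Proof. by apply: measurable_cons; [exact: measurable_fst|exact: measurable_snd]. Qed.

Section step.
Context n (mu : {measure set (Rn n) -> \bar R}).

Definition borel_step : set (Rn n.+1) -> \bar R :=
  pushforward (@lebesgue_measure R \x^ mu)%E (@tuple_cons n).

Let borel_step0 : borel_step set0 = 0%E.
Proof. by rewrite /borel_step /pushforward preimage_set0 measure0. Qed.

Let borel_step_ge0 A : (0 <= borel_step A)%E.
Proof. by rewrite /borel_step /pushforward; exact: measure_ge0. Qed.

Let borel_step_sigma_additive : semi_sigma_additive borel_step.
Proof.
move=> F mF tF mUF; rewrite /borel_step /pushforward preimage_bigcup.
apply: measure_semi_sigma_additive.
- by move=> i; rewrite -[X in measurable X]setTI; exact: measurable_tuple_cons.
- apply/trivIsetP => i j _ _ ij; rewrite -preimage_setI.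
  by move/trivIsetP : tF => /(_ _ _ _ _ ij) ->//; rewrite preimage_set0.
- by rewrite -preimage_bigcup -[X in measurable X]setTI;
    exact: measurable_tuple_cons.
Qed.

HB.instance Definition _ := isMeasure.Build _ _ _ borel_step
  borel_step0 borel_step_ge0 borel_step_sigma_additive.

End step.

Fixpoint lebesgue_borel n : {measure set (Rn n) -> \bar R} :=
  match n with
  | 0 => @dirac _ (Rn 0) [tuple] R
  | n'.+1 => borel_step (lebesgue_borel n')
  end.

Lemma lebesgue_borel_box n (A : 'I_n -> set (measurableTypeR R)) :
  (forall i, measurable (A i)) ->
  lebesgue_borel n [set t | forall i, A i (tnth t i)] =
  (\prod_(i < n) lebesgue_measure (A i))%E.
Proof.
elim: n A => [|n IH] A mA.
  rewrite big_ord0 /= diracE mem_set//.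
  by case.
rewrite big_ord_recl -IH; last by move=> i; exact: mA.
rewrite /= /borel_step /pushforward -product_measure2E//.
  congr (_ _); apply/seteqP; split => [[a t]/= At|[a t]/= [Aa At] i].
    by split => [|i]; [exact: (At ord0)|have := At (lift ord0 i); rewrite tnthS].
  by case: (unliftP ord0 i) => [j|] ->; [rewrite tnthS; exact: At|].
rewrite (_ : mkset _ = \bigcap_(i in [set: 'I_n])
    ((@tnth n (measurableTypeR R))^~ i @^-1` A (lift ord0 i))).
  apply: fin_bigcap_measurable => // i _; rewrite -[X in measurable X]setTI.
  by apply: measurable_tnth => //; exact: mA.
by apply/seteqP; split => [t At i _|t At i]; exact: At.
Qed.

Definition lebesgue_n n : set (caratheodory_type (lebesgue_borel n)^*%mu) -> \bar R :=
  @completed_measure_extension _ _ _ (lebesgue_borel n).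

HB.instance Definition _ n := Measure.on (@lebesgue_n n).

End lebesgue_measure_n.

Arguments lebesgue_n R n _ : clear implicits.

Section operator.
Context (R : realType) (dx : nat) (P : 'cV[R]_dx -> \bar R).

Definition cV_of_tuple n (t : n.-tuple R) : 'cV[R]_n := \col_i tnth t i.

Definition weighted (g : 'cV[R]_dx -> R) (t : dx.-tuple R) : \bar R :=
  (P (cV_of_tuple t) * (g (cV_of_tuple t))%:E)%E.

(* M[g] for real-valued g; extended-real valued so that M[g] < +oo is
   meaningful. *)
Definition Mscal (g : 'cV[R]_dx -> R) : \bar R :=
  (\int[lebesgue_n R dx]_t weighted g t)%E.

Definition Mop n m (pi : 'cV[R]_dx -> 'M[R]_(n, m)) : 'M[R]_(n, m) :=
  \matrix_(i, j) fine (Mscal (fun x => pi x i j)).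

(* M is well defined on every continuous matrix-valued function; that it is
   then linear and bounded is [Mop_linear] and [Mop_bounded]. *)
Definition admissible_weight : Prop :=
  (forall x, (0 <= P x)%E) /\
  (forall n m (pi : 'cV[R]_dx -> 'M[R]_(n, m)), continuous pi ->
    forall i j,
      (lebesgue_n R dx).-integrable setT (weighted (fun x => pi x i j))).

Lemma weight_fin_num : admissible_weight ->
  {ae lebesgue_n R dx, forall t, setT t -> P (cV_of_tuple t) \is a fin_num}.
Proof.
move=> [_ intP].
have c1 : continuous (fun _ : 'cV[R]_dx => 1%:M : 'M[R]_1) by exact: cst_continuous.
have := integrable_ae measurableT (intP _ _ _ c1 ord0 ord0).
by apply: filterS => t /= + _ => /(_ I); rewrite /weighted mxE eqxx mule1.
Qed.

Lemma Mop_linear n m (pi rho : 'cV[R]_dx -> 'M[R]_(n, m)) (a : R) :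
  admissible_weight -> continuous pi -> continuous rho ->
  Mop (fun x => a *: pi x + rho x) = a *: Mop pi + Mop rho.
Proof.
move=> aP cpi crho; apply/matrixP => i j; rewrite !mxE.
have ipi := aP.2 _ _ _ cpi i j; have irho := aP.2 _ _ _ crho i j.
have cZ : continuous (fun x => a *: pi x).
  by move=> x; exact: (@cvgZl_tmp _ 'M[R]_(n, m) _ _ _ _ _ _ (cpi x)).
have csum : continuous (fun x => a *: pi x + rho x).
  by move=> x; exact: (@cvgD _ 'M[R]_(n, m) _ _ _ _ _ _ _ (cZ x) (crho x)).
have isum := aP.2 _ _ _ csum i j.
have iZ := integrableZl measurableT a ipi.
rewrite -[a * _]/(fine a%:E * _) -fineM//; last exact: integrable_fin_num.
rewrite /Mscal -integralZl// -fineD; try exact: integrable_fin_num.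
rewrite -(integralD measurableT iZ irho); congr fine.
apply: ae_eq_integral; first exact: measurableT.
- exact: measurable_int isum.
- by apply: emeasurable_funD; [exact: measurable_int iZ|exact: measurable_int irho].
apply: (@filterS _ _ (ae_filter_ringOfSetsType (lebesgue_n R dx)) _ _ _
  (weight_fin_num aP)) => t /= + tT => /(_ tT).
rewrite /weighted !mxE; case: (P _) => // p _.
by rewrite -!EFinM -EFinD mulrDr mulrCA.
Qed.

Lemma Mop_bounded n m : admissible_weight ->
  exists C : R, forall (pi : 'cV[R]_dx -> 'M[R]_(n, m)) (b : R),
    continuous pi -> (forall x, `|pi x| <= b) -> `|Mop pi| <= C * b.
Proof.
move=> aP; exists (fine (Mscal (fun=> 1))) => pi b cpi pib.
have i1 : (lebesgue_n R dx).-integrable setT (weighted (fun=> 1)).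
  have c1 : continuous (fun _ : 'cV[R]_dx => const_mx 1 : 'M[R]_1)
    by exact: cst_continuous.
  have := aP.2 _ _ _ c1 ord0 ord0.
  by congr (integrable _ _ _); apply/funext => t; rewrite /weighted mxE.
have b0 : 0 <= b by apply: le_trans (pib 0).
have C0 : 0 <= fine (Mscal (fun=> 1)).
  by apply: fine_ge0; apply: integral_ge0 => t _; rewrite /weighted mule1 aP.1.
rewrite /Num.norm /= mx_normrE; apply/bigmax_leP; split => [|[i j] _ /=].
  exact: mulr_ge0.
have ipi := aP.2 _ _ _ cpi i j.
rewrite mxE -lee_fin EFinM -fine_abse; last exact: integrable_fin_num.
rewrite !fineK ?abse_fin_num; try exact: integrable_fin_num.
apply: le_trans (le_abse_integral _ measurableT (measurable_int _ ipi)) _.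
rewrite muleC -(integralZl measurableT i1).
apply: ge0_le_integral; first exact: measurableT.
- by move=> t _; exact: abse_ge0.
- exact: measurable_int (integrable_abse ipi).
- exact: measurable_int (integrableZl measurableT b i1).
move=> t _; rewrite /weighted abseM gee0_abs ?aP.1// mule1 muleC.
apply: lee_wpmul2r; first exact: aP.1.
rewrite lee_fin; apply: le_trans (pib (cV_of_tuple t)).
by rewrite [leRHS]/Num.norm/= mx_normrE; apply: (le_bigmax _ _ (i, j)).
Qed.

End operator.

Section vectors.
Context (R : realType).

Definition sqnorm n (v : 'cV[R]_n) : R := \sum_(i < n) v i ord0 ^+ 2.

Definition posdef n (L : 'M[R]_n) : Prop :=
  forall y : 'cV[R]_n, y != 0 -> 0 < (y^T *m L *m y) ord0 ord0.

(* [mxvec] is row-major, hence the transpositions. *)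
Definition vec n m (A : 'M[R]_(n, m)) : 'cV[R]_(m * n) := (mxvec A^T)^T.

(* [1; w] (x) I_d, with its 1 * d columns recast as d columns. *)
Definition one_kron n d (w : 'cV[R]_n) : 'M[R]_((1 + n) * d, d) :=
  castmx (erefl, mul1n d) (tensmx (col_mx 1%:M w) (1%:M : 'M[R]_d)).

Definition jacobian_cV n m (g : 'cV[R]_n -> 'cV[R]_m) (x : 'cV[R]_n) :
    'M[R]_(m, n) :=
  \matrix_(i, j) 'D_(delta_mx j ord0) (fun y => g y i ord0) x.

Definition gradient n (g : 'cV[R]_n -> R) (x : 'cV[R]_n) : 'cV[R]_n :=
  \col_j 'D_(delta_mx j ord0) g x.

Definition C1 n m (g : 'cV[R]_n -> 'cV[R]_m) : Prop :=
  (forall x, differentiable g x) /\ continuous (jacobian_cV g).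

(* The library notion asks for a Lipschitz bound near every pair (x, y); away
   from the diagonal this is implied by local boundedness, so it is equivalent
   to the usual one. *)
Definition locally_lipschitz n (V : normedModType R) (g : 'cV[R]_n -> V) :
    Prop :=
  [locally [lipschitz g x | x in [set: 'cV[R]_n]]].

(* The condition at infinity only excludes convergence to 0; the limit need not
   exist. *)
Definition globally_posdef n (q : 'cV[R]_n -> R) : Prop :=
  [/\ q 0 = 0, forall x, x != 0 -> 0 < q x &
      ~ forall e, 0 < e ->
          \forall r \near +oo, forall x, r <= `|x| -> `|q x| < e].

Definition minimizes n (J : 'cV[R]_n -> \bar R) (v : 'cV[R]_n) : Prop :=
  forall v', (J v <= J v')%E.

End vectors.

Section setting.
Context (R : realType) (dx du dw dv dtheta K : nat).
Context (S : set 'cV[R]_dtheta).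
Context (f : 'cV[R]_dx -> 'cV[R]_dtheta -> 'cV[R]_dx)
        (G : 'cV[R]_dx -> 'cV[R]_dtheta -> 'M[R]_(dx, du)).
Context (h : 'I_K -> 'cV[R]_dtheta -> R) (fk : 'I_K -> 'cV[R]_dx -> 'cV[R]_dx)
        (Gk : 'I_K -> 'cV[R]_dx -> 'M[R]_(dx, du)).
Context (q : 'cV[R]_dx -> R) (Rm : 'cV[R]_dx -> 'M[R]_du).
Context (Phi : 'cV[R]_dx -> 'M[R]_(dw, du)) (phi : 'cV[R]_dx -> 'cV[R]_dv).
Context (P : 'cV[R]_dx -> \bar R) (eta : R).

Definition polytopic_dynamics : Prop :=
  [/\ (0 < K)%N,
      forall k, {within S, continuous (h k)} /\
        forall theta, S theta -> 0 <= h k theta <= 1,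
      forall theta, S theta -> \sum_(k < K) h k theta = 1,
      forall k, [/\ locally_lipschitz (fk k), fk k 0 = 0 &
                    locally_lipschitz (Gk k)] &
      forall x theta, S theta ->
        f x theta = \sum_(k < K) h k theta *: fk k x /\
        G x theta = \sum_(k < K) h k theta *: Gk k x].

Definition u_hat (x : 'cV[R]_dx) (w : 'cV[R]_dw) : 'cV[R]_du := (Phi x)^T *m w.

Definition J_hat (x : 'cV[R]_dx) (v : 'cV[R]_dv) : R :=
  ((phi x)^T *m v) ord0 ord0.

Definition bellman_residual (x : 'cV[R]_dx) (v : 'cV[R]_dv) (w : 'cV[R]_dw)
    (theta : 'cV[R]_dtheta) : R :=
  q x + 2^-1 * ((u_hat x w)^T *m Rm x *m u_hat x w) ord0 ord0
  + ((gradient (J_hat^~ v) x)^T *m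
       (f x theta + G x theta *m u_hat x w)) ord0 ord0.

Definition objective (w : 'cV[R]_dw) (theta : 'cV[R]_dtheta)
    (v : 'cV[R]_dv) : \bar R :=
  (Mscal P (fun x => bellman_residual x v w theta ^+ 2)%R
   + (eta * sqnorm v)%:E)%E.

Definition psi0 (x : 'cV[R]_dx) : 'cV[R]_(1 + dw * dw) :=
  col_mx (q x)%:M (vec (2^-1 *: (Phi x *m Rm x *m (Phi x)^T))).

Definition psi (k : 'I_K) (x : 'cV[R]_dx) : 'cV[R]_((1 + dw) * dv) :=
  vec (jacobian_cV phi x *m row_mx (fk k x) (Gk k x *m (Phi x)^T)).

Definition Lkk (k k' : 'I_K) (w : 'cV[R]_dw) : 'M[R]_dv :=
  (one_kron dv w)^T *m Mop P (fun x => psi k x *m (psi k' x)^T)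
    *m one_kron dv w + eta%:M.

Definition lk (k : 'I_K) (w : 'cV[R]_dw) : 'cV[R]_dv :=
  (one_kron dv w)^T *m Mop P (fun x => psi k x *m (psi0 x)^T)
    *m col_mx 1%:M (tensmx w w).

Definition Lsum (w : 'cV[R]_dw) (theta : 'cV[R]_dtheta) : 'M[R]_dv :=
  \sum_(k < K) \sum_(k' < K) (h k theta * h k' theta) *: Lkk k k' w.

Definition v_opt (w : 'cV[R]_dw) (theta : 'cV[R]_dtheta) : 'cV[R]_dv :=
  - (invmx (Lsum w theta) *m \sum_(k < K) h k theta *: lk k w).

End setting.

(* Main.v *)
Require Import Defs.
From mathcomp Require Import all_boot all_order all_algebra.
From mathcomp Require Import all_classical all_reals all_analysis.
From mathcomp Require Import ring mxtens.
Import Order.TTheory GRing.Theory Num.Theory.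
Import numFieldNormedType.Exports.
Local Open Scope classical_set_scope.
Local Open Scope ring_scope.
Set Implicit Arguments.
Unset Strict Implicit.
Unset Printing Implicit Defensive.

(** For fixed [w] and [theta] the Bellman residual is affine in the unknown
    [v]: it equals [b x + v^T a x], where [b = q + u^T R u / 2] is the running
    cost under the feedback [u = Phi^T w], and [a] is the derivative of [phi]
    along the closed-loop vector field ([bellman_residualE]).  The minimization
    is therefore a ridge-regularized linear least-squares problem.

    Both data are linear images of the features: the vectorization identity
    [(B (x) C)^T vec A = vec (C^T A B)] gives [b = psi0^T [1; w (x) w]] and
    [a = ([1; w] (x) I)^T sum_k h_k psi_k], the latter because the closed-loop
    vector field is the [h]-average of the vertex fields.

    All the features are continuous, so their products are admissible integrands
    and the operator [Mop] commutes with the finite sums and constant matrix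
    factors that occur.  Expanding the square thus gives
    [M[(b + v^T a)^2] + eta |v|^2 = M[b^2] + 2 v^T l + v^T L v] with
    [L = M[a a^T] + eta I] and [l = M[a b]] ([regularized_residualE]).  Moving
    the constant factors back out of [Mop] identifies these [L] and [l] with the
    double sum of the [L_kk'] and the sum of the [l_k]; the weights [h_k h_k']
    add up to 1, so the ridge term is counted exactly once ([LsumE], [lsumE]).

    [L] is symmetric.  It is positive definite if [eta > 0], being then the sum
    of a Gram matrix and a positive multiple of the identity
    ([Lsum_posdef_ridge]), and also if every [L_kk'] is, being a convex
    combination of these ([Lsum_posdef_vertices]).  Completing the square then
    shows that [- L^-1 l] is the only minimizer ([unique_quadratic_min]). *)

(** * Continuity of matrix-valued functions *)

(** A basic neighbourhood of a matrix is a product of neighbourhoods of its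
    entries, and there are finitely many entries. *)
Lemma continuous_mxP (R : realType) (T : topologicalType) m n
    (g : T -> 'M[R]_(m, n)) :
  continuous g <-> forall i j, continuous (fun x => g x i j).
Proof.
split=> [cg i j x|cg x].
  exact: (continuous_comp (cg x) (@coord_continuous _ m n i j (g x))).
move=> A [Q gxQ QA].
have Qg : \forall y \near x,
    forall ij : 'I_m * 'I_n, Q ij.1 ij.2 (g y ij.1 ij.2).
  by apply: filter_forall => -[i j]; exact: cg (gxQ i j).
by apply: filterS Qg => y Qy; apply: QA => i j; exact: (Qy (i, j)).
Qed.

Lemma continuous_sumr (R : realType) (T : topologicalType) (I : finType)
    (g : I -> T -> R) :
  (forall i, continuous (g i)) -> continuous (fun x => \sum_i g i x).
Proof.
by move=> cg; apply: continuous_big => [|i _];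
  [exact: add_continuous | exact: cg].
Qed.

Lemma continuous_mulmx (R : realType) (T : topologicalType) m n p
    (g : T -> 'M[R]_(m, n)) (h : T -> 'M[R]_(n, p)) :
  continuous g -> continuous h -> continuous (fun x => g x *m h x).
Proof.
move=> /continuous_mxP cg /continuous_mxP ch; apply/continuous_mxP => i j.
under eq_fun do rewrite mxE.
by apply: continuous_sumr => k x; apply: continuousM; [exact: cg | exact: ch].
Qed.

Lemma continuous_trmx (R : realType) (T : topologicalType) m n
    (g : T -> 'M[R]_(m, n)) :
  continuous g -> continuous (fun x => (g x)^T).
Proof.
move=> /continuous_mxP cg; apply/continuous_mxP => i j.
by under eq_fun do rewrite mxE; exact: cg.
Qed.

Lemma continuous_row_mx (R : realType) (T : topologicalType) m n p
    (g : T -> 'M[R]_(m, n)) (h : T -> 'M[R]_(m, p)) :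
  continuous g -> continuous h -> continuous (fun x => row_mx (g x) (h x)).
Proof.
move=> /continuous_mxP cg /continuous_mxP ch; apply/continuous_mxP => i j.
case: (splitP j) => k jk.
  rewrite (_ : j = lshift p k); last exact: val_inj.
  by under eq_fun do rewrite row_mxEl; exact: cg.
rewrite (_ : j = rshift n k); last exact: val_inj.
by under eq_fun do rewrite row_mxEr; exact: ch.
Qed.

Lemma continuous_col_mx (R : realType) (T : topologicalType) m n p
    (g : T -> 'M[R]_(m, p)) (h : T -> 'M[R]_(n, p)) :
  continuous g -> continuous h -> continuous (fun x => col_mx (g x) (h x)).
Proof.
move=> /continuous_trmx cg /continuous_trmx ch.
have := continuous_trmx (continuous_row_mx cg ch).
by under eq_fun do rewrite tr_row_mx !trmxK.
Qed.

(** The Lipschitz bound near the diagonal pair [(x, x)] is applied to the pairs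
    [(x, y)] with [y] near [x]. *)
Lemma locally_lipschitz_continuous (R : realType) n (V : normedModType R)
    (g : 'cV[R]_n -> V) :
  locally_lipschitz g -> continuous g.
Proof.
move=> gL x; have := gL (x, x) (conj I I).
rewrite /lipschitz_on /= => /pinfty_ex_gt0[M M0].
rewrite /dominated_by /within /= => -[[U V'] /= [Ux Vx] UVg].
apply/(cvgrPdist_le (FF := nbhs_filter (x : 'cV[R]_n))) => e e0.
have xe : \forall y \near x, `|x - y| <= M^-1 * e.
  apply/nbhs_ballP; exists (M^-1 * e); first by rewrite /= mulr_gt0 ?invr_gt0.
  by move=> y; rewrite -ball_normE /= => /ltW.
apply: filterS2 Vx xe => y V'y xye.
have /= /le_trans := UVg (x, y) (conj (nbhs_singleton Ux) V'y) (conj I I).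
by apply; rewrite -ler_pdivlMl.
Qed.

(** * Vectorization and Kronecker products *)

Lemma index_allpairs (S T : eqType) (s : seq S) (t : seq T) a b :
  a \in s -> b \in t ->
  index (a, b) [seq (x, y) | x <- s, y <- t] =
  (index a s * size t + index b t)%N.
Proof.
move=> + bt; elim: s => //= x s IH; rewrite inE eq_sym index_cat.
case: eqVneq => /= [<- _|xa a_s].
  by rewrite map_f // index_map // => y z [].
have /negbTE -> : (a, b) \notin [seq (x, y) | y <- t].
  by apply/mapP => -[y _ [ax _]]; rewrite ax eqxx in xa.
by rewrite size_map IH // addnA mulSn.
Qed.

(** [mxvec] numbers the entries through the enumeration of the product type,
    whereas [tensmx] uses [i * n + j] directly; the two agree because that
    enumeration is lexicographic.  This is what lets [vec] and the Kronecker
    product be combined. *)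
Lemma mxvec_mxtens_index m n (i : 'I_m) (j : 'I_n) :
  mxvec_index i j = mxtens_index (i, j).
Proof.
apply: val_inj => /=.
have <- : index (i, j) (enum {: 'I_m * 'I_n}) = enum_rank (i, j).
  rewrite -{1}(nth_enum_rank (i, j) (i, j)) index_uniq ?enum_uniq //.
  by rewrite -cardE ltn_ord.
rewrite enumT unlock /= /prod_enum.
by rewrite index_allpairs ?mem_enum // -!cardE !card_ord !index_enum_ord.
Qed.

Lemma vecE (R : realType) m n (A : 'M[R]_(m, n)) i j :
  vec A (mxtens_index (i, j)) 0 = A j i.
Proof. by rewrite mxE -mxvec_mxtens_index mxvecE mxE. Qed.

Lemma continuous_vec (R : realType) (T : topologicalType) m n
    (g : T -> 'M[R]_(m, n)) :
  continuous g -> continuous (fun x => vec (g x)).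
Proof.
move=> /continuous_mxP cg; apply/continuous_mxP => k z; rewrite ord1.
by case: (mxtens_indexP k) => i j; under eq_fun do rewrite vecE; exact: cg.
Qed.

(** This turns an expression linear in [A] into a constant matrix times the
    vector [vec A], so that the constants can be taken out of an integral. *)
Lemma vec_mul (R : realType) m n p q (C : 'M[R]_(n, q)) (A : 'M[R]_(n, m))
    (B : 'M[R]_(m, p)) :
  vec (C^T *m A *m B) = (tensmx B C)^T *m vec A.
Proof.
apply/colP => k; case: (mxtens_indexP k) => j i; rewrite vecE !mxE.
under eq_bigr do rewrite mxE big_distrl /=.
rewrite pair_bigA /= (reindex (@mxtens_index m n)) /=; last first.
  by exists (@mxtens_unindex m n) => ? _;
    rewrite (mxtens_indexK, mxtens_unindexK).
apply: eq_bigr => -[l r] _.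
by rewrite vecE !mxE !mxtens_indexK /= mulrC mulrA.
Qed.

(** The case [B = [1; w]], [C = I] of [vec_mul].  The Kronecker product has
    [1 * d] columns and [vec] returns [1 * d] rows, hence the reindexing. *)
Lemma one_kron_vec (R : realType) n d (w : 'cV[R]_n) (A : 'M[R]_(d, 1 + n)) :
  (one_kron d w)^T *m vec A = A *m col_mx 1%:M w.
Proof.
have := vec_mul 1%:M A (col_mx 1%:M w); rewrite trmx1 mul1mx => E.
rewrite /one_kron trmx_cast /=.
apply/colP => i; have /colP/(_ (mxtens_index (ord0, i))) := E.
rewrite vecE => ->; rewrite !mxE; apply: eq_bigr => k _; congr (_ * _).
rewrite castmxE /= cast_ord_id; congr (_ _ _).
by apply: val_inj => /=; rewrite add0n.
Qed.

Lemma tensmx_sq_vec (R : realType) n (w : 'cV[R]_n) (A : 'M[R]_n) :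
  (tensmx w w)^T *m vec A = w^T *m A *m w.
Proof.
rewrite -vec_mul; apply/colP => i.
rewrite [LHS](_ : _ = vec (w^T *m A *m w) (mxtens_index (ord0, ord0)) 0).
  by rewrite vecE !ord1.
by congr (_ _ _); apply: val_inj; case: i => -[].
Qed.

(** * Minimizing a positive definite quadratic *)

Lemma posdef_unitmx (R : realType) n (L : 'M[R]_n) : posdef L -> L \in unitmx.
Proof.
move=> L_pos; rewrite -row_free_unit -kermx_eq0; apply/eqP/row_matrixP => i.
rewrite row0; apply/eqP; apply: contraT => u0.
have /L_pos : (row i (kermx L))^T != 0 by rewrite -trmx0 (inj_eq trmx_inj).
by rewrite trmxK -row_mul mulmx_ker row0 mul0mx mxE ltxx.
Qed.

(** Completing the square: with [u = - L^-1 l], symmetry of [L] gives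
    [J v = J u + (v - u)^T L (v - u)], whose last term is positive unless
    [v = u]. *)
Lemma unique_quadratic_min (R : realType) n (L : 'M[R]_n) (l : 'cV[R]_n)
    (c : R) (J : 'cV[R]_n -> \bar R) :
  L^T = L -> posdef L ->
  (forall v, J v = (c + 2 * (v^T *m l) ord0 ord0
                      + (v^T *m L *m v) ord0 ord0)%:E) ->
  unique (minimizes J) (- (invmx L *m l)).
Proof.
move=> L_sym L_pos JE; move Eu: (- _) => u.
have Lu : l = - (L *m u).
  by rewrite -Eu mulmxN opprK mulmxA mulmxV ?mul1mx ?posdef_unitmx.
have Jsub v : J v = (J u + (((v - u)^T *m L *m (v - u)) ord0 ord0)%:E)%E.
  rewrite !JE -EFinD; congr EFin; rewrite Lu.
  have uLv : (u^T *m L *m v) ord0 ord0 = (v^T *m L *m u) ord0 ord0.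
    have -> : u^T *m L *m v = (v^T *m L *m u)^T.
      by rewrite !trmx_mul trmxK L_sym mulmxA.
    by rewrite mxE.
  rewrite [(v - u)^T]linearB /= !mulmxBl !mulmxBr !mulmxN !mulmxA.
  move: uLv; move: (u^T *m L *m v) (v^T *m L *m u).
  move: (v^T *m L *m v) (u^T *m L *m u).
  by move=> vv uu uv vu; rewrite !mxE => ->; ring.
split=> [v|v u_min].
  rewrite (Jsub v) leeDl // lee_fin; have [->|] := eqVneq v u.
    by rewrite subrr mulmx0 mxE.
  by rewrite -subr_eq0 => /L_pos/ltW.
apply/eqP; apply: contraT; rewrite eq_sym -subr_eq0 => /L_pos.
by rewrite ltNge -lee_fin -(leeD2lE (x := J u)) ?adde0 -?Jsub ?u_min // JE.
Qed.

(** * The weighted integral operator *)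

Section operator.
Context (R : realType) (d : nat) (P : 'cV[R]_d -> \bar R).
Context (P_adm : admissible_weight P).

Lemma Mscal_fin_num g : continuous g -> Mscal P g \is a fin_num.
Proof.
move=> cg; have cG : continuous (fun x => const_mx (g x) : 'M[R]_1).
  by apply/continuous_mxP => i j; under eq_fun do rewrite mxE.
rewrite /Mscal; apply: integrable_fin_num => //.
have := P_adm.2 _ _ _ cG ord0 ord0.
by congr (integrable _ _ _); apply/funext => t; rewrite /weighted mxE.
Qed.

Lemma Mop_sum n m (I : finType) (c : I -> R)
    (pi : I -> 'cV[R]_d -> 'M[R]_(n, m)) :
  (forall i, continuous (pi i)) ->
  Mop P (fun x => \sum_i c i *: pi i x) = \sum_i c i *: Mop P (pi i).
Proof.
move=> cpi.
have cZ i : continuous (fun x => c i *: pi i x).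
  by move=> x; exact: (@cvgZl_tmp _ 'M[R]_(n, m) _ _ _ _ _ _ (cpi i x)).
have Mop0 : Mop P (fun _ => 0 : 'M[R]_(n, m)) = 0.
  apply/matrixP => i j; rewrite !mxE /Mscal integral0_eq // => t _.
  by rewrite /weighted ?mxE mule0.
have csum s : continuous (fun x => \sum_(i <- s) c i *: pi i x).
  elim: s => [|i s IH].
    by under eq_fun do rewrite big_nil; exact: cst_continuous.
  under eq_fun do rewrite big_cons; move=> x.
  exact: (@cvgD _ 'M[R]_(n, m) _ _ _ _ _ _ _ (cZ i x) (IH x)).
elim: (index_enum I) => [|i s IH].
  by under eq_fun do rewrite big_nil; rewrite big_nil.
by under eq_fun do rewrite big_cons; rewrite big_cons Mop_linear // IH.
Qed.

Lemma Mop_trmx n m (pi : 'cV[R]_d -> 'M[R]_(n, m)) :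
  Mop P (fun x => (pi x)^T) = (Mop P pi)^T.
Proof. by apply/matrixP => i j; rewrite !mxE; under eq_fun do rewrite mxE. Qed.

(** Every entry of [A *m pi x] is a linear combination of entries of [pi x], so
    this is linearity of [Mop] on scalar functions, seen as 1 x 1 matrices. *)
Lemma Mop_mull n m p (A : 'M[R]_(p, n)) (pi : 'cV[R]_d -> 'M[R]_(n, m)) :
  continuous pi -> Mop P (fun x => A *m pi x) = A *m Mop P pi.
Proof.
move=> /continuous_mxP cpi; apply/matrixP => i j.
pose row k x : 'M[R]_1 := const_mx (pi x k j).
have crow k : continuous (row k).
  by apply/continuous_mxP => a b; under eq_fun do rewrite mxE; exact: cpi.
transitivity (Mop P (fun x => \sum_k A i k *: row k x) ord0 ord0).
  rewrite !mxE; congr (fine (Mscal P _)); apply/funext => x.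
  by rewrite mxE summxE; apply: eq_bigr => k _; rewrite !mxE.
rewrite Mop_sum // summxE mxE; apply: eq_bigr => k _; rewrite !mxE.
by congr (_ * fine (Mscal P _)); apply/funext => x; rewrite mxE.
Qed.

Lemma Mop_mulr n m p (A : 'M[R]_(m, p)) (pi : 'cV[R]_d -> 'M[R]_(n, m)) :
  continuous pi -> Mop P (fun x => pi x *m A) = Mop P pi *m A.
Proof.
move=> /continuous_trmx cpi; apply: trmx_inj; rewrite -Mop_trmx trmx_mul.
by under eq_fun do rewrite trmx_mul; rewrite Mop_mull // Mop_trmx.
Qed.

(** Expansion of the ridge least-squares objective as a quadratic polynomial in
    [v].  The square of the residual is integrable because it is continuous. *)
Lemma regularized_residualE n (a : 'cV[R]_d -> 'cV[R]_n)
    (b : 'cV[R]_d -> 'M[R]_1) (eta : R) (v : 'cV[R]_n) :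
  continuous a -> continuous b ->
  (Mscal P (fun x => (b x + v^T *m a x) ord0 ord0 ^+ 2)%R
     + (eta * sqnorm v)%:E)%E =
  (Mop P (fun x => b x *m b x) ord0 ord0
     + 2 * (v^T *m Mop P (fun x => a x *m b x)) ord0 ord0
     + (v^T *m (Mop P (fun x => a x *m (a x)^T) + eta%:M) *m v) ord0 ord0)%:E.
Proof.
move=> ca cb.
have cv : continuous (fun _ : 'cV[R]_d => v) by exact: cst_continuous.
have cvT : continuous (fun _ : 'cV[R]_d => v^T) by exact: cst_continuous.
have cbb := continuous_mulmx cb cb.
have cab := continuous_mulmx ca cb.
have caa := continuous_mulmx ca (continuous_trmx ca).
have cvab := continuous_mulmx cvT cab.
have cvaa := continuous_mulmx cvT caa.
have cvaav := continuous_mulmx cvaa cv.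
have cbvaav : continuous
    (fun x => 1 *: (b x *m b x) + v^T *m (a x *m (a x)^T) *m v).
  move=> x; under eq_fun do rewrite scale1r.
  exact: (@cvgD _ 'M[R]_1 _ _ _ _ _ _ _ (cbb x) (cvaav x)).
(* The coefficients 2 and 1 match the shape [a *: pi + rho] of [Mop_linear]. *)
have eE x : (b x + v^T *m a x) ord0 ord0 ^+ 2 =
    (2 *: (v^T *m (a x *m b x))
       + (1 *: (b x *m b x) + v^T *m (a x *m (a x)^T) *m v)) ord0 ord0.
  have -> : v^T *m (a x *m (a x)^T) *m v = (v^T *m a x) *m (v^T *m a x)^T.
    by rewrite trmx_mul trmxK !mulmxA.
  rewrite [v^T *m (_ *m _)]mulmxA; move: (v^T *m a x) (b x) => s r.
  by rewrite !mxE !big_ord1 !mxE; ring.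
under eq_fun do rewrite eE.
rewrite -[X in (X + _)%E]fineK; last first.
  apply: Mscal_fin_num.
  apply: (continuous_mxP _).1 => x.
  apply: (@cvgD _ 'M[R]_1 _ _ _ _ _ _ _ _ (cbvaav x)).
  exact: (@cvgZl_tmp _ 'M[R]_1 _ _ _ _ _ _ (cvab x)).
rewrite -EFinD; congr EFin.
have := Mop_linear 2 P_adm cvab cbvaav; rewrite (Mop_linear 1 P_adm cbb cvaav).
move=> /matrixP/(_ ord0 ord0); rewrite mxE => ->.
rewrite Mop_mull // Mop_mulr // Mop_mull // mulmxDr mulmxDl.
have -> : eta * sqnorm v = (v^T *m eta%:M *m v) ord0 ord0.
  rewrite mul_mx_scalar -scalemxAl !mxE; congr (_ * _).
  by apply: eq_bigr => i _; rewrite mxE expr2.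
rewrite scale1r; move: (v^T *m eta%:M *m v) => A; move: (v^T *m _ *m v) => B.
move: (Mop P (fun x => a x *m b x)) (Mop P (fun x => b x *m b x)) => C D.
by move: (v^T *m C) => E; rewrite !mxE; ring.
Qed.

Lemma Mop_gram_sym n (a : 'cV[R]_d -> 'cV[R]_n) :
  (Mop P (fun x => a x *m (a x)^T))^T = Mop P (fun x => a x *m (a x)^T).
Proof. by rewrite -Mop_trmx; under eq_fun do rewrite trmx_mul trmxK. Qed.

(** The quadratic form of [M[a a^T]] at [y] is the integral of [(y^T a)^2]
    against a nonnegative weight. *)
Lemma Mop_gram_ge0 n (a : 'cV[R]_d -> 'cV[R]_n) (y : 'cV[R]_n) :
  continuous a -> 0 <= (y^T *m Mop P (fun x => a x *m (a x)^T) *m y) ord0 ord0.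
Proof.
move=> ca; have caa := continuous_mulmx ca (continuous_trmx ca).
rewrite -Mop_mull // -Mop_mulr; last first.
  by apply: continuous_mulmx caa; exact: cst_continuous.
rewrite mxE; apply: fine_ge0; apply: integral_ge0 => t _.
apply: mule_ge0; first exact: P_adm.1.
rewrite lee_fin mulmxA -mulmxA -[(_ ^T *m y)]trmxK trmx_mul trmxK.
by move: (y^T *m _) => s; rewrite mxE big_ord1 mxE -expr2 sqr_ge0.
Qed.

End operator.

(** * The Bellman residual as a regression problem *)

(** Differentiability of [phi] makes the directional derivative commute with
    the linear combination [v] of the coordinates of [phi]. *)
Lemma gradient_J_hat (R : realType) dx dv (phi : 'cV[R]_dx -> 'cV[R]_dv) v x :
  differentiable phi x ->
  gradient (J_hat phi ^~ v) x = (jacobian_cV phi x)^T *m v.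
Proof.
move=> dphi; apply/colP => j; rewrite !mxE.
have dc i : derivable (fun y => phi y i ord0) x (delta_mx j ord0).
  apply: diff_derivable.
  exact: (differentiable_comp dphi (differentiable_coord _ i ord0)).
rewrite (_ : (J_hat phi)^~ v = \sum_i v i ord0 \*: (fun y => phi y i ord0)).
  rewrite derive_sum => [|i]; last exact: derivableZ.
  by apply: eq_bigr => i _; rewrite deriveZ // !mxE mulrC.
apply/funext => y; rewrite /J_hat mxE fct_sumE.
by apply: eq_bigr => i _; rewrite mxE mulrC.
Qed.

Section setting.
Context (R : realType) (dx du dw dv dtheta K : nat).
Context (f : 'cV[R]_dx -> 'cV[R]_dtheta -> 'cV[R]_dx)
        (G : 'cV[R]_dx -> 'cV[R]_dtheta -> 'M[R]_(dx, du)).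
Context (h : 'I_K -> 'cV[R]_dtheta -> R) (fk : 'I_K -> 'cV[R]_dx -> 'cV[R]_dx)
        (Gk : 'I_K -> 'cV[R]_dx -> 'M[R]_(dx, du)).
Context (q : 'cV[R]_dx -> R) (Rm : 'cV[R]_dx -> 'M[R]_du).
Context (Phi : 'cV[R]_dx -> 'M[R]_(dw, du)) (phi : 'cV[R]_dx -> 'cV[R]_dv).
Context (P : 'cV[R]_dx -> \bar R) (eta : R).
Context (w : 'cV[R]_dw) (theta : 'cV[R]_dtheta).

Context (P_adm : admissible_weight P).
Context (q_cont : continuous q).
Context (Rm_cont : continuous Rm).
Context (Phi_lip : locally_lipschitz Phi).
Context (fk_lip : forall k, locally_lipschitz (fk k)).
Context (Gk_lip : forall k, locally_lipschitz (Gk k)).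
Context (phi_C1 : C1 phi).
Context (h_sum : \sum_k h k theta = 1).

(** The coefficient of [v] in the Bellman residual: the Jacobian of [phi]
    applied to the closed-loop vector field under [u = Phi^T w]. *)
Definition regressor x : 'cV[R]_dv :=
  \sum_k h k theta *: ((one_kron dv w)^T *m psi fk Gk Phi phi k x).

(** The part [q + u^T R u / 2] of the Bellman residual that does not depend on
    [v], at the feedback [u = Phi^T w]. *)
Definition running_cost x : 'M[R]_1 :=
  (psi0 q Rm Phi x)^T *m col_mx 1%:M (tensmx w w).

Lemma psi_continuous k : continuous (psi fk Gk Phi phi k).
Proof.
apply: continuous_vec; apply: continuous_mulmx; first exact: phi_C1.2.
apply: continuous_row_mx; first exact/locally_lipschitz_continuous.
by apply: continuous_mulmx; [|apply: continuous_trmx];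
  exact: locally_lipschitz_continuous.
Qed.

Lemma psi0_continuous : continuous (psi0 q Rm Phi).
Proof.
have cPhi := locally_lipschitz_continuous Phi_lip.
have cPRP := continuous_mulmx (continuous_mulmx cPhi Rm_cont)
  (continuous_trmx cPhi).
apply: continuous_col_mx.
  by apply/continuous_mxP => i j; under eq_fun do rewrite !ord1 mxE eqxx.
apply: continuous_vec => x.
exact: (@cvgZl_tmp _ 'M[R]_dw _ _ _ _ _ _ (cPRP x)).
Qed.

Lemma kron_psi_continuous k :
  continuous (fun x => (one_kron dv w)^T *m psi fk Gk Phi phi k x).
Proof.
by apply: continuous_mulmx (@psi_continuous k); exact: cst_continuous.
Qed.

Lemma regressor_continuous : continuous regressor.
Proof.
apply/continuous_mxP => i j; under eq_fun do rewrite summxE.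
apply: continuous_sumr => k x; under eq_fun do rewrite mxE.
apply: continuousM; first exact: cst_continuous.
by have /continuous_mxP := @kron_psi_continuous k; exact.
Qed.

Lemma running_cost_continuous : continuous running_cost.
Proof.
apply: continuous_mulmx; last exact: cst_continuous.
exact: continuous_trmx psi0_continuous.
Qed.

Lemma bellman_residualE x v :
  f x theta = \sum_k h k theta *: fk k x ->
  G x theta = \sum_k h k theta *: Gk k x ->
  bellman_residual f G q Rm Phi phi x v w theta =
  (running_cost x + v^T *m regressor x) ord0 ord0.
Proof.
move=> fE GE; rewrite [RHS]mxE; congr (_ + _).
  have -> : running_cost x =
      ((col_mx 1%:M (tensmx w w))^T *m psi0 q Rm Phi x)^T.
    by rewrite trmx_mul trmxK.
  rewrite [RHS]mxE tr_col_mx mul_row_col tr_scalar_mx mul1mx tensmx_sq_vec.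
  rewrite -scalemxAr -scalemxAl [RHS]mxE [X in _ = X + _]mxE eqxx.
  rewrite mulr1n [X in _ = _ + X]mxE; congr (_ + _ * _).
  by rewrite /u_hat trmx_mul trmxK !mulmxA.
rewrite gradient_J_hat; last exact: phi_C1.1.
rewrite trmx_mul trmxK -mulmxA; congr ((v^T *m _) ord0 ord0).
rewrite fE GE /regressor mulmx_suml -big_split mulmx_sumr.
apply: eq_bigr => k _.
rewrite one_kron_vec -mulmxA mul_row_col mulmx1 /u_hat mulmxA.
by rewrite /= -2!scalemxAl -scalerDr -scalemxAr ?mulmxA.
Qed.

(** The features are moved inside [Mop], where the double sum over vertices
    factors as [a a^T].  Since the weights [h_i h_j] sum to 1, the copies of
    [eta I] add up to a single one. *)
Lemma LsumE : Lsum h fk Gk Phi phi P eta w theta =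
  Mop P (fun x => regressor x *m (regressor x)^T) + eta%:M.
Proof.
pose a k x := (one_kron dv w)^T *m psi fk Gk Phi phi k x.
have ca k : continuous (a k) := @kron_psi_continuous k.
have caa k k' := continuous_mulmx (ca k) (continuous_trmx (ca k')).
have aaE x : regressor x *m (regressor x)^T =
    \sum_ij (h ij.1 theta * h ij.2 theta) *: (a ij.1 x *m (a ij.2 x)^T).
  rewrite -(pair_bigA _ (fun i j => (h i theta * h j theta) *:
    (a i x *m (a j x)^T))) /= mulmx_suml; apply: eq_bigr => i _.
  rewrite linear_sum mulmx_sumr; apply: eq_bigr => j _.
  by rewrite linearZ /= -scalemxAl -scalemxAr scalerA.
under eq_fun do rewrite aaE.
rewrite (Mop_sum P_adm) //= -(pair_bigA _ (fun i j => (h i theta * h j theta) *: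
  Mop P (fun x => a i x *m (a j x)^T))) /=.
have <- : \sum_i \sum_j (h i theta * h j theta) *: (eta%:M : 'M[R]_dv) = eta%:M.
  under eq_bigr do rewrite -scaler_suml -mulr_sumr h_sum mulr1.
  by rewrite -scaler_suml h_sum scale1r.
rewrite -big_split; apply: eq_bigr => i _; rewrite -big_split.
apply: eq_bigr => j _ /=; rewrite -scalerDr /Lkk; congr (_ *: (_ + _)).
have cpp := continuous_mulmx (@psi_continuous i)
  (continuous_trmx (@psi_continuous j)).
rewrite -(Mop_mull P_adm) // -(Mop_mulr P_adm); last first.
  by apply: continuous_mulmx cpp; exact: cst_continuous.
by congr (Mop P _); apply/funext => x;
  rewrite /a trmx_mul (trmxK (one_kron _ _)) !mulmxA.
Qed.

Lemma lsumE : \sum_k h k theta *: lk fk Gk q Rm Phi phi P k w =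
  Mop P (fun x => regressor x *m running_cost x).
Proof.
pose a k x := (one_kron dv w)^T *m psi fk Gk Phi phi k x.
have ao x : regressor x *m running_cost x =
    \sum_k h k theta *: (a k x *m running_cost x).
  by rewrite mulmx_suml; apply: eq_bigr => k _; rewrite -scalemxAl.
rewrite (funext ao).
rewrite (Mop_sum P_adm) => [|k]; last first.
  exact: continuous_mulmx (@kron_psi_continuous k) running_cost_continuous.
apply: eq_bigr => k _; congr (_ *: _).
have cpp := continuous_mulmx (@psi_continuous k)
  (continuous_trmx psi0_continuous).
rewrite /lk -(Mop_mull P_adm) // -(Mop_mulr P_adm); last first.
  by apply: continuous_mulmx cpp; exact: cst_continuous.
by congr (Mop P _); apply/funext => x; rewrite /a /running_cost !mulmxA.
Qed.

Lemma Lsum_sym : (Lsum h fk Gk Phi phi P eta w theta)^T =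
  Lsum h fk Gk Phi phi P eta w theta.
Proof. by rewrite LsumE linearD /= Mop_gram_sym tr_scalar_mx. Qed.

Lemma Lsum_posdef_ridge : 0 < eta ->
  posdef (Lsum h fk Gk Phi phi P eta w theta).
Proof.
move=> eta0 y y0; rewrite LsumE mulmxDr mulmxDl mxE ltr_wpDl //.
  exact/Mop_gram_ge0/regressor_continuous.
rewrite mul_mx_scalar -scalemxAl mxE mulr_gt0 // mxE.
have [i yi0] : exists i, y i ord0 != 0 by apply/cV0Pn.
rewrite (bigD1 i) //= ltr_pwDl //; first by rewrite mxE -expr2 exprn_even_gt0.
by apply: sumr_ge0 => j _; rewrite mxE -expr2 sqr_ge0.
Qed.

(** Some weight [h_k] is positive, as they sum to 1; the diagonal term
    [h_k^2 y^T L_kk y] is then positive and no other term is negative. *)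
Lemma Lsum_posdef_vertices : (forall k, 0 <= h k theta) ->
  (forall k k', posdef (Lkk fk Gk Phi phi P eta k k' w)) ->
  posdef (Lsum h fk Gk Phi phi P eta w theta).
Proof.
move=> h0 L_pos y y0.
have [k hk] : exists k, 0 < h k theta.
  apply: contrapT => /forallNP h_le0; have := h_sum; rewrite big1 => [/eqP|k _].
    by rewrite eq_sym oner_eq0.
  by apply/eqP; rewrite eq_le h0 leNgt andbT; apply/negP/h_le0.
have t_ge0 i j : 0 <= h i theta * h j theta *
    (y^T *m Lkk fk Gk Phi phi P eta i j w *m y) ord0 ord0.
  by rewrite !mulr_ge0 ?h0 // ltW // L_pos.
have -> : (y^T *m Lsum h fk Gk Phi phi P eta w theta *m y) ord0 ord0 =
    \sum_i \sum_j h i theta * h j theta *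
    (y^T *m Lkk fk Gk Phi phi P eta i j w *m y) ord0 ord0.
  rewrite /Lsum mulmx_sumr mulmx_suml summxE; apply: eq_bigr => i _.
  rewrite mulmx_sumr mulmx_suml summxE; apply: eq_bigr => j _.
  by rewrite -scalemxAr -scalemxAl mxE.
rewrite (bigD1 k) //= ltr_pwDl //; last first.
  by apply: sumr_ge0 => i _; apply: sumr_ge0.
rewrite (bigD1 k) //= ltr_pwDl ?mulr_gt0 ?L_pos //.
by apply: sumr_ge0.
Qed.

End setting.

Theorem theorem2 (R : realType) (dx du dw dv dtheta K : nat)
    (S : set 'cV[R]_dtheta)
    (f : 'cV[R]_dx -> 'cV[R]_dtheta -> 'cV[R]_dx)
    (G : 'cV[R]_dx -> 'cV[R]_dtheta -> 'M[R]_(dx, du))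
    (h : 'I_K -> 'cV[R]_dtheta -> R)
    (fk : 'I_K -> 'cV[R]_dx -> 'cV[R]_dx)
    (Gk : 'I_K -> 'cV[R]_dx -> 'M[R]_(dx, du))
    (q : 'cV[R]_dx -> R) (Rm : 'cV[R]_dx -> 'M[R]_du)
    (Phi : 'cV[R]_dx -> 'M[R]_(dw, du)) (phi : 'cV[R]_dx -> 'cV[R]_dv)
    (P : 'cV[R]_dx -> \bar R) (eta : R) :
  polytopic_dynamics S f G h fk Gk ->
  continuous q -> globally_posdef q ->
  continuous Rm -> (forall x, (Rm x)^T = Rm x /\ posdef (Rm x)) ->
  locally_lipschitz Phi ->
  C1 phi -> phi 0 = 0 ->
  admissible_weight P ->
  0 <= eta ->
  (Mscal P (fun x => sqnorm (psi0 q Rm Phi x)) < +oo)%E ->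
  (forall k, Mscal P (fun x => sqnorm (psi fk Gk Phi phi k x)) < +oo)%E ->
  forall (w : 'cV[R]_dw) (theta : 'cV[R]_dtheta), S theta ->
    (0 < eta \/
     (forall k k', posdef (Lkk fk Gk Phi phi P eta k k' w))) ->
    Lsum h fk Gk Phi phi P eta w theta \in unitmx /\
    unique (minimizes (objective f G q Rm Phi phi P eta w theta))
      (v_opt h fk Gk q Rm Phi phi P eta w theta).
Proof.
move=> [_ h01 h_sum fG_lip fG] q_cont _ Rm_cont _ Phi_lip phi_C1 _ P_adm _ _ _.
move=> w theta theta_S eta_or_L.
have fk_lip k : locally_lipschitz (fk k) by have [] := fG_lip k.
have Gk_lip k : locally_lipschitz (Gk k) by have [] := fG_lip k.
have {}h_sum := h_sum theta theta_S.
have L_pos : posdef (Lsum h fk Gk Phi phi P eta w theta).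
  case: eta_or_L => [eta0|]; first exact: Lsum_posdef_ridge.
  by apply: Lsum_posdef_vertices => // k; have /andP[] := (h01 k).2 _ theta_S.
split; first exact: posdef_unitmx.
rewrite /v_opt lsumE //.
pose a := regressor h fk Gk Phi phi w theta; pose b := running_cost q Rm Phi w.
apply: (@unique_quadratic_min _ _ _ _
  (Mop P (fun x => b x *m b x) ord0 ord0)) => //.
  exact: Lsum_sym.
move=> v; rewrite LsumE // -regularized_residualE //.
- congr (_ + _)%E; congr (Mscal P _); apply/funext => x; congr (_ ^+ 2).
  by have [fE GE] := fG x _ theta_S; exact: bellman_residualE.
- exact: regressor_continuous.
- exact: running_cost_continuous.
Qed.
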